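(* The data $(U_-,X)$ are informative for controllability (i.e. every $(A,B)\in\Sigma_{i/s}$ is controllable) if and only if $$\operatorname{rank}(X_+-\lambda X_-)=n\quad\text{for all }\lambda\in\mathbb{C}.$$ Similarly, the data $(U_-,X)$ are informative for stabilizability (i.e. every $(A,B)\in\Sigma_{i/s}$ is stabilizable) if and only if $$\operatorname{rank}(X_+-\lambda X_-)=n\quad\text{for all }\lambda\in\mathbb{C}\text{ with }|\lambda|\ge 1.$$
   Context: Fix positive integers $n,m,q,T_1,\dots,T_q$. Let $(A_s,B_s)\in\mathbb{R}^{n\times n}\times\mathbb{R}^{n\times m}$ be the 'true' system $x(t+1)=A_sx(t)+B_su(t)$. For $i=1,\dots,q$ let $u^i(0),\dots,u^i(T_i-1)\in\mathbb{R}^m$ and $x^i(0),\dots,x^i(T_i)\in\mathbb{R}^n$ be input/state data generated by this system, i.e. $x^i(t+1)=A_sx^i(t)+B_su^i(t)$ for $t=0,\dots,T_i-1$. Put $U^i_-=[u^i(0)\ \cdots\ u^i(T_i-1)]$, $X^i=[x^i(0)\ \cdots\ x^i(T_i)]$, $X^i_-=[x^i(0)\ \cdots\ x^i(T_i-1)]$, $X^i_+=[x^i(1)\ \cdots\ x^i(T_i)]$, and $U_-=[U^1_-\ \cdots\ U^q_-]$, $X=[X^1\ \cdots\ X^q]$, $X_-=[X^1_-\ \cdots\ X^q_-]$, $X_+=[X^1_+\ \cdots\ X^q_+]$; thus $X_+=A_sX_-+B_sU_-$. The set of systems consistent with the data is $$\Sigma_{i/s}=\Big\{(A,B)\in\mathbb{R}^{n\times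 n}\times\mathbb{R}^{n\times m}\ \Big|\ X_+=\begin{bmatrix}A & B\end{bmatrix}\begin{bmatrix}X_- \\ U_- \end{bmatrix}\Big\}.$$ A pair $(A,B)$ is controllable if and only if $\operatorname{rank}[A-\lambda I\ \ B]=n$ for all $\lambda\in\mathbb{C}$; it is stabilizable (discrete time) if and only if this holds for all $\lambda\in\mathbb{C}$ with $|\lambda|\ge1$. *)

(* Defs.v *)
From mathcomp Require Import all_boot all_order all_algebra.
From mathcomp Require Import reals.
From mathcomp Require Export complex.

Set Implicit Arguments.
Unset Strict Implicit.
Unset Printing Implicit Defensive.

Import Order.TTheory GRing.Theory Num.Theory.
Local Open Scope ring_scope.
Local Open Scope complex_scope.

Definition cmx (R : realType) (k l : nat) (M : 'M[R]_(k, l)) : 'M[R[i]]_(k, l) :=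
  map_mx (real_complex R) M.

(* Hautus tests, with lambda ranging over the complex numbers R[i]; the norm on
   R[i] is valued in R[i], so [1 <= `|lambda|] compares two (real) elements of
   R[i]. *)
Definition controllable (R : realType) (n m : nat)
    (A : 'M[R]_n) (B : 'M[R]_(n, m)) : Prop :=
  forall lambda : R[i], \rank (row_mx (cmx A - lambda%:M) (cmx B)) = n.

Definition stabilizable (R : realType) (n m : nat)
    (A : 'M[R]_n) (B : 'M[R]_(n, m)) : Prop :=
  forall lambda : R[i], 1 <= `|lambda| ->
    \rank (row_mx (cmx A - lambda%:M) (cmx B)) = n.

(* Trajectory i has T i inputs u i 0, ..., u i (T i - 1) and (T i).+1 states
   x i 0, ..., x i (T i): for t : 'I_(T i), [now t] is the index t and [next t]
   the index t + 1 of 'I_(T i).+1. *)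
Definition now (k : nat) (t : 'I_k) : 'I_k.+1 := widen_ord (leqnSn k) t.
Definition next (k : nat) (t : 'I_k) : 'I_k.+1 := lift ord0 t.

Definition generated_by (R : realType) (n m q : nat) (T : 'I_q -> nat)
    (A : 'M[R]_n) (B : 'M[R]_(n, m))
    (u : forall i : 'I_q, 'I_(T i) -> 'cV[R]_m)
    (x : forall i : 'I_q, 'I_(T i).+1 -> 'cV[R]_n) : Prop :=
  forall (i : 'I_q) (t : 'I_(T i)),
    x i (next t) = A *m x i (now t) + B *m u i t.

Definition Uminus (R : realType) (m q : nat) (T : 'I_q -> nat)
    (u : forall i : 'I_q, 'I_(T i) -> 'cV[R]_m) : 'M[R]_(m, \sum_i T i) :=
  \mxrow_(i < q) \matrix_(k < m, t < T i) u i t k 0.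

Definition Xminus (R : realType) (n q : nat) (T : 'I_q -> nat)
    (x : forall i : 'I_q, 'I_(T i).+1 -> 'cV[R]_n) : 'M[R]_(n, \sum_i T i) :=
  \mxrow_(i < q) \matrix_(k < n, t < T i) x i (now t) k 0.

Definition Xplus (R : realType) (n q : nat) (T : 'I_q -> nat)
    (x : forall i : 'I_q, 'I_(T i).+1 -> 'cV[R]_n) : 'M[R]_(n, \sum_i T i) :=
  \mxrow_(i < q) \matrix_(k < n, t < T i) x i (next t) k 0.

(* Membership of (A, B) in Sigma_{i/s}. *)
Definition consistent (R : realType) (n m q : nat) (T : 'I_q -> nat)
    (u : forall i : 'I_q, 'I_(T i) -> 'cV[R]_m)
    (x : forall i : 'I_q, 'I_(T i).+1 -> 'cV[R]_n)
    (A : 'M[R]_n) (B : 'M[R]_(n, m)) : Prop :=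
  Xplus x = row_mx A B *m col_mx (Xminus x) (Uminus u).

Definition informative (R : realType) (n m q : nat) (T : 'I_q -> nat)
    (u : forall i : 'I_q, 'I_(T i) -> 'cV[R]_m)
    (x : forall i : 'I_q, 'I_(T i).+1 -> 'cV[R]_n)
    (P : 'M[R]_n -> 'M[R]_(n, m) -> Prop) : Prop :=
  forall (A : 'M[R]_n) (B : 'M[R]_(n, m)), consistent u x A B -> P A B.

(* Main.v *)
(** If [z] is a complex left null vector of [X_+ - lambda X_-] and [M] has rows
    [Re z], [Im z], then [M X_+ = L M X_-] for the real 2x2 matrix [L] of
    [lambda].  When [M] has full row rank, a correction [(As, Bs) - V K], with
    [V] a right inverse of [M] and [K] annihilating the data, gives a consistent
    [(A, B)] with [M A = L M] and [M B = 0], which fails the Hautus test at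
    [lambda].  Otherwise [z] is proportional to a real vector [r]; then either
    [r X_- = r X_+ = 0], so [lambda] may be replaced by [1] (which satisfies
    [1 <= |1|]), or [lambda] is itself real, and the same correction applies
    with [M = r]. *)
Require Import Defs.
From mathcomp Require Import all_boot all_order all_algebra.
From mathcomp Require Import reals.

Set Implicit Arguments.
Unset Strict Implicit.
Unset Printing Implicit Defensive.

Import Order.TTheory GRing.Theory Num.Theory.
Local Open Scope ring_scope.
Local Open Scope complex_scope.

Lemma rank_neq_kernel (F : fieldType) (n p : nat) (A : 'M[F]_(n, p)) :
  \rank A != n -> exists2 z : 'rV_n, z != 0 & z *m A = 0.
Proof.
rewrite -/(row_free A) -kermx_eq0 => /rowV0Pn[z /sub_kermxP zA z0].
by exists z.
Qed.

Lemma rank_eq_kernel (F : fieldType) (n p : nat) (A : 'M[F]_(n, p))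
    (z : 'rV_n) : \rank A = n -> z *m A = 0 -> z = 0.
Proof.
by move/eqP=> freeA zA; apply: (row_free_inj freeA); rewrite mul0mx.
Qed.

(** The correction is V K with K = [M A0 - L M, M B0]. It preserves the data because K [Xm; U] = M
    Xp - L M Xm = 0, and M V = 1 makes it cancel exactly the defects in M A = L M and M B = 0. *)
Lemma invariant_correction (F : fieldType) (k n m p : nat)
    (A0 : 'M[F]_n) (B0 : 'M[F]_(n, m)) (Xp Xm : 'M[F]_(n, p)) (U : 'M[F]_(m, p))
    (M : 'M[F]_(k, n)) (L : 'M[F]_k) :
  Xp = A0 *m Xm + B0 *m U -> row_free M -> M *m Xp = L *m M *m Xm ->
  exists A : 'M[F]_n, exists B : 'M[F]_(n, m),
    [/\ Xp = A *m Xm + B *m U, M *m A = L *m M & M *m B = 0].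
Proof.
move=> data freeM MXp.
have [V MV] : exists V, M *m V = 1%:M by exists (pinvmx M); exact: mulmxVp.
exists (A0 - V *m (M *m A0 - L *m M)), (B0 - V *m (M *m B0)); split.
- rewrite !mulmxBl addrACA -data -opprD -[in LHS](subr0 Xp); congr (_ - _).
  rewrite -!mulmxA -mulmxDr mulmxBl addrAC -!mulmxA -mulmxDr -data MXp.
  by rewrite mulmxA subrr mulmx0.
- by rewrite mulmxBr (mulmxA M V) MV mul1mx opprB addrC subrK.
- by rewrite mulmxBr (mulmxA M V) MV mul1mx subrr.
Qed.

Section ComplexMatrices.
Variable R : realType.

(** Real and imaginary parts are compared: lambda = c + i d acts on the pair (a', b') through the
    real blocks c, -d, d, c. *)
Lemma cmx_scale (k l : nat) (lambda : R[i]) (a b a' b' : 'M[R]_(k, l)) :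
  cmx a + 'i *: cmx b = lambda *: (cmx a' + 'i *: cmx b') ->
  a = complex.Re lambda *: a' - complex.Im lambda *: b' /\
  b = complex.Im lambda *: a' + complex.Re lambda *: b'.
Proof.
case: lambda => c d /matrixP ab.
split; apply/matrixP=> i j; move: (ab i j); rewrite !mxE; simpc => -[] // _ ->.
by rewrite addrC.
Qed.

Lemma cmx_Re_Im (k l : nat) (z : 'M[R[i]]_(k, l)) :
  z = cmx (map_mx (@complex.Re R) z) + 'i *: cmx (map_mx (@complex.Im R) z).
Proof. by apply/matrixP=> i j; rewrite !mxE; case: (z i j) => x y; simpc. Qed.

(** The vector y M is a left null vector of the Hautus matrix, since y M A = y L M = lambda y M and
    y M B = 0. It is nonzero because M keeps its full row rank over [R[i]]. *)
Lemma uncontrollable_mode (k n m p : nat)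
    (A0 : 'M[R]_n) (B0 : 'M[R]_(n, m)) (Xp Xm : 'M[R]_(n, p)) (U : 'M[R]_(m, p))
    (M : 'M[R]_(k, n)) (L : 'M[R]_k) (y : 'rV[R[i]]_k) (lambda : R[i]) :
  Xp = A0 *m Xm + B0 *m U -> row_free M -> M *m Xp = L *m M *m Xm ->
  y != 0 -> y *m cmx L = lambda *: y ->
  exists A : 'M[R]_n, exists B : 'M[R]_(n, m),
    Xp = A *m Xm + B *m U /\
    \rank (row_mx (cmx A - lambda%:M) (cmx B)) <> n.
Proof.
move=> data freeM MXp y0 yL.
have [A [B [AB MA MB]]] := invariant_correction data freeM MXp.
exists A, B; split=> // rk; move: y0; rewrite -[_ == _]negbK => /negP; apply.
have freeM' : row_free (cmx M) by rewrite /row_free mxrank_map.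
rewrite negbK; apply/eqP/(row_free_inj freeM'); rewrite mul0mx.
apply: (rank_eq_kernel rk).
rewrite mul_mx_row mulmxBr mul_mx_scalar -!mulmxA -!map_mxM MA MB.
by rewrite map_mx0 mulmx0 map_mxM mulmxA yL scalemxAl subrr row_mx0.
Qed.

Lemma uncontrollable_real_mode (n m p : nat)
    (A0 : 'M[R]_n) (B0 : 'M[R]_(n, m)) (Xp Xm : 'M[R]_(n, p)) (U : 'M[R]_(m, p))
    (r : 'rV[R]_n) (mu : R) :
  Xp = A0 *m Xm + B0 *m U -> r != 0 -> r *m Xp = mu *: (r *m Xm) ->
  exists A : 'M[R]_n, exists B : 'M[R]_(n, m),
    Xp = A *m Xm + B *m U /\
    \rank (row_mx (cmx A - (mu%:C)%:M) (cmx B)) <> n.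
Proof.
move=> data r0 rX.
apply: (@uncontrollable_mode 1 _ _ _ _ _ _ _ _ r mu%:M 1%:M _ data).
- by rewrite /row_free rank_rV r0.
- by rewrite mul_scalar_mx -scalemxAl.
- by apply/eqP=> /matrixP/(_ 0 0)/eqP; rewrite !mxE oner_eq0.
- by rewrite mul1mx /cmx map_scalar_mx scale_scalar_mx mulr1.
Qed.

Lemma uncontrollable_complex_line (n m p : nat)
    (A0 : 'M[R]_n) (B0 : 'M[R]_(n, m)) (Xp Xm : 'M[R]_(n, p)) (U : 'M[R]_(m, p))
    (r : 'rV[R]_n) (lambda : R[i]) :
  Xp = A0 *m Xm + B0 *m U -> r != 0 ->
  cmx (r *m Xp) = lambda *: cmx (r *m Xm) ->
  exists A : 'M[R]_n, exists B : 'M[R]_(n, m), exists mu : R[i],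
    [/\ Xp = A *m Xm + B *m U, mu = lambda \/ mu = 1 &
        \rank (row_mx (cmx A - mu%:M) (cmx B)) <> n].
Proof.
move=> data r0 rX.
suff [mu [rX' mul]] : exists mu : R,
    r *m Xp = mu *: (r *m Xm) /\ (mu%:C = lambda \/ mu%:C = 1).
  have [A [B [? ?]]] := uncontrollable_real_mode data r0 rX'.
  by exists A, B, mu%:C.
have [Xm0|[j Xmj]] : r *m Xm = 0 \/ exists j, (r *m Xm) 0 j != 0.
- have [/eqP|/rV0Pn] := boolP (r *m Xm == 0); [by left | by right].
(* Here r Xp vanishes as well, so any mu satisfies the equation; 1 is the choice allowed by the
   second disjunct. *)
- exists 1; split; last by right.
  apply: (@map_mx_inj _ _ (real_complex R)).
  by move: rX; rewrite Xm0 scaler0 /cmx map_mx0 scaler0.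
(* Both vectors are real, so a nonzero entry of r Xm exhibits lambda as a quotient of reals. *)
have lE : ((r *m Xp) 0 j / (r *m Xm) 0 j)%:C = lambda.
  move/matrixP: rX => /(_ 0 j); rewrite mxE [in RHS]mxE [X in _ * X]mxE => rXj.
  rewrite rmorphM /= fmorphV; apply: (canLR (mulfK _)); last exact: rXj.
  by rewrite fmorph_eq0.
exists ((r *m Xp) 0 j / (r *m Xm) 0 j); split; last by left.
by apply: (@map_mx_inj _ _ (real_complex R)); rewrite map_mxZ /= lE.
Qed.

Lemma uncontrollable_pencil (n m p : nat)
    (A0 : 'M[R]_n) (B0 : 'M[R]_(n, m)) (Xp Xm : 'M[R]_(n, p)) (U : 'M[R]_(m, p))
    (lambda : R[i]) :
  Xp = A0 *m Xm + B0 *m U -> \rank (cmx Xp - lambda *: cmx Xm) <> n ->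
  exists A : 'M[R]_n, exists B : 'M[R]_(n, m), exists mu : R[i],
    [/\ Xp = A *m Xm + B *m U, mu = lambda \/ mu = 1 &
        \rank (row_mx (cmx A - mu%:M) (cmx B)) <> n].
Proof.
move=> data /eqP/rank_neq_kernel[z z0].
rewrite mulmxBr -scalemxAr => /subr0_eq.
move: z0; rewrite [z]cmx_Re_Im;
  move: (map_mx (@complex.Re R) z) (map_mx (@complex.Im R) z) => a b z0 zX.
(* This settles the case of linearly dependent a and b: the null vector is c r, and cancelling the
   nonzero c leaves the pencil equation for the real vector r. *)
have line (c : R[i]) (r : 'rV[R]_n) :
    cmx a + 'i *: cmx b = c *: cmx r ->
    exists A : 'M[R]_n, exists B : 'M[R]_(n, m), exists mu : R[i],
    [/\ Xp = A *m Xm + B *m U, mu = lambda \/ mu = 1 &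
        \rank (row_mx (cmx A - mu%:M) (cmx B)) <> n].
  move=> zE; move: z0; rewrite zE scalemx_eq0 negb_or map_mx_eq0 => /andP[c0 r0].
  apply: uncontrollable_complex_line data r0 _.
  apply: (scalerI c0); rewrite /cmx !map_mxM [LHS]scalemxAl -/(cmx r) -zE zX zE.
  by rewrite -scalemxAl !scalerA mulrC.
have [a0|a0] := eqVneq a 0.
  by apply: (line 'i b); rewrite a0 /cmx map_mx0 add0r.
have [/sub_rVP[t bE]|ba] := boolP (b <= a)%MS.
  apply: (line (1 + 'i * t%:C) a).
  by rewrite bE scalerDl scale1r /cmx map_mxZ scalerA.
have /cmx_scale[aX bX] : cmx (a *m Xp) + 'i *: cmx (b *m Xp) =
    lambda *: (cmx (a *m Xm) + 'i *: cmx (b *m Xm)).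
  by move: zX; rewrite !mulmxDl -!scalemxAl /cmx !map_mxM.
pose c := complex.Re lambda; pose d := complex.Im lambda.
have [A [B [AB rk]]] : exists A : 'M[R]_n, exists B : 'M[R]_(n, m),
    Xp = A *m Xm + B *m U /\ \rank (row_mx (cmx A - lambda%:M) (cmx B)) <> n.
  (* The row (1, i) is a left eigenvector of the block matrix: (c + i d, -d + i c) = lambda (1, i).
     Its product with the rows a, b is the original null vector a + i b. *)
  apply: (@uncontrollable_mode (1 + 1)%N _ _ _ _ _ _ _ _ (col_mx a b)
    (block_mx c%:M (- d)%:M d%:M c%:M) (row_mx 1%:M 'i%:M) _ data).
  (* As b lies outside the line spanned by a, the span of both strictly contains that line and so
     has rank at least 2. *)
  - rewrite /row_free eqn_leq rank_leq_row -addsmxE /=.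
    have := rank_ltmx (_ : (a < a + b)%MS); rewrite rank_rV a0; apply.
    by rewrite ltmxE addsmxSl addsmx_sub submx_refl.
  - rewrite mul_col_mx mul_block_col mul_col_mx !mul_scalar_mx aX bX scaleNr.
    by rewrite mulmxBl mulmxDl -!scalemxAl.
  - by apply/eqP=> /rowP/(_ (lshift _ 0))/eqP; rewrite row_mxEl !mxE oner_eq0.
  - rewrite /cmx map_block_mx !map_scalar_mx mul_row_block -!scalar_mxM.
    rewrite -!raddfD scale_row_mx !scale_scalar_mx /c /d.
    by congr (row_mx _%:M _%:M); case: (lambda) => ? ?; simpc.
by exists A, B, lambda; split=> //; left.
Qed.

End ComplexMatrices.

Lemma Xplus_generated (R : realType) (n m q : nat) (T : 'I_q -> nat)
    (As : 'M[R]_n) (Bs : 'M[R]_(n, m))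
    (u : forall i : 'I_q, 'I_(T i) -> 'cV[R]_m)
    (x : forall i : 'I_q, 'I_(T i).+1 -> 'cV[R]_n) :
  generated_by As Bs u x ->
  Xplus x = As *m Xminus x + Bs *m Uminus u.
Proof.
move=> data; rewrite /Xplus !mul_mxrow -mxrowD; apply: eq_mxrow => i.
apply/matrixP=> k t; rewrite !mxE data !mxE.
by congr (_ + _); apply: eq_bigr => l _; rewrite !mxE.
Qed.

(** The predicate S treats both claims at once: all lambda, or those with |lambda| >= 1. It is
    assumed to hold at 1 because a rank drop at lambda may yield a system that fails the Hautus test
    at 1 instead. *)
Lemma informative_hautus (R : realType) (n m q : nat) (T : 'I_q -> nat)
    (As : 'M[R]_n) (Bs : 'M[R]_(n, m))
    (u : forall i : 'I_q, 'I_(T i) -> 'cV[R]_m)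
    (x : forall i : 'I_q, 'I_(T i).+1 -> 'cV[R]_n) (S : R[i] -> Prop) :
  generated_by As Bs u x -> S 1 ->
  informative u x (fun A B => forall lambda, S lambda ->
    \rank (row_mx (cmx A - lambda%:M) (cmx B)) = n) <->
  forall lambda, S lambda ->
    \rank (cmx (Xplus x) - lambda *: cmx (Xminus x)) = n.
Proof.
move=> /Xplus_generated data S1; split=> [inf|rk A B AB] lambda Sl.
  apply/eqP/negPn/negP=> /eqP /(uncontrollable_pencil data).
  move=> [A [B [mu [AB mul]]]]; apply; apply: inf.
    by rewrite /consistent mul_row_col.
  by case: mul => ->.
apply/eqP/negPn/negP=> /rank_neq_kernel[z /negP z0 zAB]; apply/z0/eqP.
apply: (rank_eq_kernel (rk _ Sl)).
(* Consistency factors the pencil through the Hautus matrix of (A, B), so a left null vector of the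
   latter annihilates the pencil. *)
have -> : cmx (Xplus x) - lambda *: cmx (Xminus x) =
    row_mx (cmx A - lambda%:M) (cmx B) *m cmx (col_mx (Xminus x) (Uminus u)).
  rewrite AB /cmx map_mxM map_row_mx map_col_mx !mul_row_col mulmxBl.
  by rewrite mul_scalar_mx addrAC.
by rewrite mulmxA zAB mul0mx.
Qed.

Theorem theorem8 (R : realType) (n m q : nat) (T : 'I_q -> nat)
    (n_gt0 : (0 < n)%N) (m_gt0 : (0 < m)%N) (q_gt0 : (0 < q)%N)
    (T_gt0 : forall i : 'I_q, (0 < T i)%N)
    (As : 'M[R]_n) (Bs : 'M[R]_(n, m))
    (u : forall i : 'I_q, 'I_(T i) -> 'cV[R]_m)
    (x : forall i : 'I_q, 'I_(T i).+1 -> 'cV[R]_n)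
    (data_ux : generated_by As Bs u x) :
  (informative u x (@controllable R n m) <->
     forall lambda : R[i],
       \rank (cmx (Xplus x) - lambda *: cmx (Xminus x)) = n)
  /\
  (informative u x (@stabilizable R n m) <->
     forall lambda : R[i], 1 <= `|lambda| ->
       \rank (cmx (Xplus x) - lambda *: cmx (Xminus x)) = n).
Proof.
split; last by apply: informative_hautus data_ux _; rewrite normr1.
have [inf rk] := informative_hautus (S := fun=> True) data_ux I.
split=> [ctrl lambda|rank A B AB lambda].
  by apply: inf => // A B AB mu _; apply: ctrl.
by apply: rk => // mu _; apply: rank.
Qed.
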